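(* Let $X$ be a Tychonoff space. The function $$\gamma:\big(\mathcal T(X),\leq\big)\rightarrow\big(\mathcal I(C^*(X)),\subseteq\big),\qquad \gamma(Y)=\big\{f|X: f\in C^*(Y)\text{ and }f(p)=0\big\}\quad\text{for }Y=X\cup\{p\}\in\mathcal T(X),$$ is an order-isomorphism onto its image.
   Context: For a Tychonoff space $X$, a one-point extension of $X$ is a Tychonoff space $Y$ containing $X$ as a dense subspace such that $Y\setminus X$ is a singleton; we write $Y=X\cup\{p\}$. Two extensions are identified if there is a homeomorphism between them fixing $X$ pointwise. For extensions $Y_1,Y_2$ of $X$, $Y_2\leq Y_1$ means there is a continuous $f:Y_1\to Y_2$ fixing $X$ pointwise; this is a partial order on the set $\mathcal T(X)$ of all (equivalence classes of) one-point extensions of $X$. $C^*(X)$ is the ring of all bounded continuous real-valued functions on $X$, and $\mathcal I(C^*(X))$ is the set of all ideals of $C^*(X)$. An order-isomorphism is a bijection that is order-preserving with order-preserving inverse. *)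

(* Defs.v *)
From HB Require Import structures.
From mathcomp Require Import all_boot all_order all_algebra.
From mathcomp Require Import all_classical all_reals all_analysis.

Set Implicit Arguments.
Unset Strict Implicit.
Unset Printing Implicit Defensive.

Import Order.TTheory GRing.Theory Num.Theory numFieldNormedType.Exports.

Local Open Scope classical_set_scope.
Local Open Scope ring_scope.

(* [completely_regular_space] does not include any separation axiom. *)
Definition tychonoff_space (X : topologicalType) : Prop :=
  completely_regular_space X /\ hausdorff_space X.

Section BoundedContinuousFunctions.
Variables (R : realType) (X : topologicalType).
Implicit Types f g : X -> R.

Definition bounded_continuous : {pred X -> R} :=
  fun f => `[< continuous f /\ [bounded f x | x in [set: X]] >].

Lemma bounded_onTP f :
  [bounded f x | x in [set: X]] <-> exists M, forall x, `|f x| <= M.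
Proof.
split=> [[M [_ fM]]|[M fM]].
  by exists (M + 1) => x; apply: (fM (M + 1)) => //; rewrite ltrDl.
exists M; split; first exact: num_real.
by move=> N MN x _; apply: le_trans (fM x) (ltW MN).
Qed.

Lemma bounded_continuousP f :
  reflect (continuous f /\ exists M, forall x, `|f x| <= M)
          (f \in bounded_continuous).
Proof.
by apply: (iffP idP) => [/asboolP|] [cf /bounded_onTP bf] //;
  apply/asboolP; split.
Qed.

Lemma bounded_continuous_subring : subring_closed bounded_continuous.
Proof.
split.
- apply/bounded_continuousP; split; first by move=> x; exact: cvg_cst.
  by exists 1 => x; rewrite normr1.
- move=> f g /bounded_continuousP[cf [M fM]] /bounded_continuousP[cg [N gN]].
  apply/bounded_continuousP; split.
    by move=> x; apply: cvgB; [exact: cf|exact: cg].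
  by exists (M + N) => x; apply: le_trans (ler_normB _ _) (lerD _ _).
- move=> f g /bounded_continuousP[cf [M fM]] /bounded_continuousP[cg [N gN]].
  apply/bounded_continuousP; split.
    by move=> x; apply: cvgM; [exact: cf|exact: cg].
  by exists (M * N) => x; rewrite normrM; apply: ler_pM.
Qed.

(* The ring C*(X), with the pointwise operations of [X -> R]. *)
Record Cstar := MkCstar {
  Cstar_fun :> X -> R;
  Cstar_subproof : Cstar_fun \in bounded_continuous
}.

HB.instance Definition _ := [isSub for Cstar_fun].
HB.instance Definition _ := [Choice of Cstar by <:].
HB.instance Definition _ := GRing.SubChoice_isSubComPzRing.Build (X -> R)
  bounded_continuous Cstar bounded_continuous_subring.

End BoundedContinuousFunctions.

(* Ideals need not be proper, contrary to those of [ring_quotient]. *)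
Record ring_ideal (A : comPzRingType) := RingIdeal {
  ideal_set :> set A;
  ideal0 : ideal_set 0;
  idealD : forall a b, ideal_set a -> ideal_set b -> ideal_set (a + b);
  idealM : forall a b, ideal_set b -> ideal_set (a * b)
}.

Definition ideal_le (A : comPzRingType) (I J : ring_ideal A) : Prop :=
  I `<=` J.

(* [f] identifies [X] with a subspace of [Y]. *)
Definition topological_embedding (X Y : topologicalType) (f : X -> Y) : Prop :=
  injective f /\
  forall U : set X, open U <-> exists2 V : set Y, open V & f @^-1` V = U.

(* The inclusion of [X] in [Y = X \cup {p}] is the map [ext_incl]. *)
Record one_point_extension (X : topologicalType) := OnePointExtension {
  ext_space :> topologicalType;
  ext_incl : X -> ext_space;
  ext_pt : ext_space;
  ext_tychonoff : tychonoff_space ext_space;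
  ext_embedding : topological_embedding ext_incl;
  ext_dense : dense (range ext_incl);
  ext_remainder : ~` range ext_incl = [set ext_pt]
}.

Section OnePointExtensions.
Variable X : topologicalType.
Implicit Types Y Z : one_point_extension X.

Definition ext_equiv Y Z : Prop :=
  exists f : Y -> Z, exists g : Z -> Y,
    [/\ continuous f, continuous g, cancel f g, cancel g f
      & forall x, f (ext_incl Y x) = ext_incl Z x].

Definition ext_le Y Z : Prop :=
  exists2 f : Z -> Y, continuous f & forall x, f (ext_incl Z x) = ext_incl Y x.

Lemma ext_equiv_refl Y : ext_equiv Y Y.
Proof. by exists id, id; split => // y; exact: cvg_id. Qed.

Lemma ext_equiv_sym Y Z : ext_equiv Y Z -> ext_equiv Z Y.
Proof.
move=> [f [g [cf cg fK gK fX]]]; exists g, f; split => // x.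
by rewrite -fX fK.
Qed.

Lemma ext_equiv_trans Y Z W : ext_equiv Y Z -> ext_equiv Z W -> ext_equiv Y W.
Proof.
move=> [f [g [cf cg fK gK fX]]] [f' [g' [cf' cg' fK' gK' fX']]].
exists (f' \o f), (g \o g'); split.
- by move=> y; apply: continuous_comp; [exact: cf|exact: cf'].
- by move=> y; apply: continuous_comp; [exact: cg'|exact: cg].
- by move=> y /=; rewrite fK' fK.
- by move=> y /=; rewrite gK gK'.
- by move=> x /=; rewrite fX fX'.
Qed.

Lemma ext_le_refl Y : ext_le Y Y.
Proof. by exists id => // y; exact: cvg_id. Qed.

Lemma ext_le_trans Y Z W : ext_le Y Z -> ext_le Z W -> ext_le Y W.
Proof.
move=> [f cf fX] [g cg gX]; exists (f \o g) => [y|x] /=.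
  by apply: continuous_comp; [exact: cg|exact: cf].
by rewrite gX fX.
Qed.

Lemma ext_equiv_le Y Z : ext_equiv Y Z -> ext_le Y Z.
Proof. by move=> /ext_equiv_sym[f [g [cf _ _ _ fX]]]; exists f. Qed.

(* A continuous selfmap of [Y] fixing [X] pointwise is the identity. *)
Lemma ext_endo_id Y (f : Y -> Y) :
  continuous f -> (forall x, f (ext_incl Y x) = ext_incl Y x) -> f =1 id.
Proof.
move=> cf fX y; apply: (ext_tychonoff Y).2 => A B Afy By.
have : nbhs y (f @^-1` A `&` B) by apply: filterI => //; exact: cf.
rewrite nbhsE => -[V [oV Vy] VAB].
have [z [Vz [x _ xz]]] := ext_dense (ex_intro _ y Vy) oV.
by have [Afz Bz] := VAB _ Vz; exists z; split => //; rewrite -xz /= fX in Afz *.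
Qed.

Lemma ext_le_anti Y Z : ext_le Y Z -> ext_le Z Y -> ext_equiv Y Z.
Proof.
move=> [f cf fX] [g cg gX]; exists g, f; split => //.
  apply: (@ext_endo_id Y (f \o g)) => [y|x] /=; last by rewrite gX fX.
  by apply: continuous_comp; [exact: cg|exact: cf].
apply: (@ext_endo_id Z (g \o f)) => [y|x] /=; last by rewrite fX gX.
by apply: continuous_comp; [exact: cf|exact: cg].
Qed.

(* T(X): an element is an equivalence class of extensions. The quotients of
   MathComp are not available since [one_point_extension X] is too large to be
   the carrier of a [choiceType]. *)
Definition extension_class : Type :=
  {C : one_point_extension X -> Prop | exists Y, C = [eta ext_equiv Y]}.

Definition class_of Y : extension_class :=
  exist _ [eta ext_equiv Y] (ex_intro _ Y erefl).

Lemma class_nonempty (C : extension_class) : exists Y, sval C Y.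
Proof. by case: C => C /= [Y ->]; exists Y; exact: ext_equiv_refl. Qed.

Definition repr_ext (C : extension_class) : one_point_extension X :=
  sval (cid (class_nonempty C)).

Lemma class_eq Y Z : ext_equiv Y Z -> class_of Y = class_of Z.
Proof.
move=> YZ; apply: eq_exist => /=; apply/funext => W /=; apply/propext; split.
  exact/ext_equiv_trans/ext_equiv_sym.
exact: ext_equiv_trans.
Qed.

Lemma repr_extP Y : ext_equiv Y (repr_ext (class_of Y)).
Proof. by rewrite /repr_ext; case: cid. Qed.

Lemma repr_extK : cancel repr_ext class_of.
Proof.
move=> [C CP]; rewrite /repr_ext; case: cid => Z /= CZ; apply: eq_exist => /=.
case: CP CZ => Y -> YZ.
by have /(congr1 sval) := class_eq YZ.
Qed.

Definition class_le (C D : extension_class) : Prop :=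
  ext_le (repr_ext C) (repr_ext D).

Lemma class_leE Y Z : class_le (class_of Y) (class_of Z) <-> ext_le Y Z.
Proof.
have [YY' ZZ'] := (repr_extP Y, repr_extP Z); split => le.
  apply: ext_le_trans (ext_equiv_le YY') (ext_le_trans le _).
  exact/ext_equiv_le/ext_equiv_sym.
apply: ext_le_trans (ext_equiv_le (ext_equiv_sym YY')) (ext_le_trans le _).
exact/ext_equiv_le.
Qed.

Lemma class_le_refl C : class_le C C.
Proof. exact: ext_le_refl. Qed.

Lemma class_le_trans C D E : class_le C D -> class_le D E -> class_le C E.
Proof. exact: ext_le_trans. Qed.

Lemma class_le_anti C D : class_le C D -> class_le D C -> C = D.
Proof.
move=> CD DC; rewrite -(repr_extK C) -(repr_extK D).
exact/class_eq/ext_le_anti.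
Qed.

End OnePointExtensions.

Section Gamma.
Variables (R : realType) (X : topologicalType).
Implicit Types Y Z : one_point_extension X.

Lemma ext_incl_continuous Y : continuous (ext_incl Y).
Proof.
apply/continuousP => V oV; apply/(ext_embedding Y).2.
by exists V.
Qed.

Lemma ext_restr_subproof Y (f : Cstar R Y) :
  f \o ext_incl Y \in @bounded_continuous R X.
Proof.
have /bounded_continuousP[cf [M fM]] := Cstar_subproof f.
apply/bounded_continuousP; split; last by exists M => x; exact: fM.
by move=> x; apply: continuous_comp; [exact: ext_incl_continuous|exact: cf].
Qed.

Definition ext_restr Y (f : Cstar R Y) : Cstar R X :=
  MkCstar (ext_restr_subproof f).

Definition gamma_set Y : set (Cstar R X) :=
  [set ext_restr f | f in [set f : Cstar R Y | f (ext_pt Y) = 0]].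

Lemma gamma_set0 Y : gamma_set Y 0.
Proof. by exists 0 => //; exact: val_inj. Qed.

Lemma gamma_setD Y h k : gamma_set Y h -> gamma_set Y k -> gamma_set Y (h + k).
Proof.
move=> [f fp <-] [g gp <-]; exists (f + g); last exact: val_inj.
by rewrite /= -[LHS]/(f (ext_pt Y) + g (ext_pt Y)) fp gp addr0.
Qed.

Lemma ext_incl_neq Y x : ext_incl Y x <> ext_pt Y.
Proof.
move=> xp; have : (~` range (ext_incl Y)) (ext_pt Y) by rewrite ext_remainder.
by apply; exists x.
Qed.

Lemma ext_cases Y (y : Y) : y = ext_pt Y \/ exists x, ext_incl Y x = y.
Proof.
have [[x _ <-]|ny] := pselect (range (ext_incl Y) y); first by right; exists x.
by left; have : [set ext_pt Y] y by rewrite -ext_remainder.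
Qed.

Lemma gamma_setM Y h k : gamma_set Y k -> gamma_set Y (h * k).
Proof.
move=> [f fp <-].
have /bounded_continuousP[cf [M fM]] := Cstar_subproof f.
have /bounded_continuousP[ch [N hN]] := Cstar_subproof h.
pose ext (y : Y) : R := if pselect (exists x, ext_incl Y x = y) is left xP
  then h (sval (cid xP)) * f y else 0.
have extX x : ext (ext_incl Y x) = h x * f (ext_incl Y x).
  rewrite /ext; case: pselect => [xP|[]]; last by exists x.
  by case: cid => x' xx' /=; have -> := (ext_embedding Y).1 _ _ xx'.
have extp : ext (ext_pt Y) = 0.
  by rewrite /ext; case: pselect => // xP; have [x /ext_incl_neq] := xP.
have extle y : `|ext y| <= (`|N| + 1) * `|f y|.
  have [->|[x <-]] := ext_cases y.
    by rewrite extp normr0 mulr_ge0// addr_ge0.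
  rewrite extX normrM ler_wpM2r//; apply: le_trans (hN x) _.
  by rewrite (le_trans (ler_norm N))// lerDl.
suff ext_bc : ext \in @bounded_continuous R Y.
  exists (MkCstar ext_bc) => //; apply: val_inj; apply/funext => x /=.
  exact: extX.
apply/bounded_continuousP; split; last first.
  exists ((`|N| + 1) * M) => y; apply: le_trans (extle y) _.
  by rewrite ler_wpM2l// addr_ge0.
move=> y; have [->|[x <-]] := ext_cases y.
  rewrite /continuous_at extp; apply: norm_cvg0.
  apply: (@squeeze_cvgr _ _ _ _ (cst 0) (fun y => (`|N| + 1) * `|f y|)).
  - by near=> z; rewrite normr_ge0 extle.
  - exact: cvg_cst.
  - have -> : 0 = (`|N| + 1) * `|f (ext_pt Y)| by rewrite fp normr0 mulr0.
    by apply: cvgMr; apply: cvg_norm; exact: cf.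
have chf : continuous (fun x => h x * f (ext_incl Y x)).
  move=> z; apply: cvgM; first exact: ch.
  by apply: continuous_comp; [exact: ext_incl_continuous|exact: cf].
move=> W; rewrite /= extX => /(chf x); rewrite nbhsE /= => -[U [oU Ux] UW].
have [V oV VU] := ((ext_embedding Y).2 U).1 oU.
have oX : open (range (ext_incl Y)).
  rewrite -[range _]setCK ext_remainder openC.
  by apply: accessible_closed_set1; apply: hausdorff_accessible;
    exact: (ext_tychonoff Y).2.
have : nbhs (ext_incl Y x) (V `&` range (ext_incl Y)).
  apply: open_nbhs_nbhs; split; first exact: openI.
  by split; [rewrite -VU in Ux|exists x].
apply: filterS => y' [Vy' [z _ zE]]; rewrite -zE in Vy' *.
by rewrite /= extX; apply: UW; rewrite -VU.
Unshelve. all: by end_near.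
Qed.

Definition gamma_ideal Y : ring_ideal (Cstar R X) :=
  RingIdeal (@gamma_set0 Y) (@gamma_setD Y) (@gamma_setM Y).

Definition gamma (C : extension_class X) : ring_ideal (Cstar R X) :=
  gamma_ideal (repr_ext C).

Lemma ext_equiv_pt Y Z (f : Y -> Z) (g : Z -> Y) : cancel f g ->
  (forall x, g (ext_incl Z x) = ext_incl Y x) -> f (ext_pt Y) = ext_pt Z.
Proof.
move=> fK gX; have [//|[x fpx]] := ext_cases (f (ext_pt Y)).
by exfalso; apply: (@ext_incl_neq Y x); rewrite -gX fpx fK.
Qed.

Lemma gamma_set_equiv Y Z : ext_equiv Y Z -> gamma_set Y `<=` gamma_set Z.
Proof.
move=> [u [v [_ cv uK vK uX]]] _ [f fp <-].
have vX x : v (ext_incl Z x) = ext_incl Y x by rewrite -uX uK.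
have /bounded_continuousP[cf [M fM]] := Cstar_subproof f.
have fv : f \o v \in @bounded_continuous R Z.
  apply/bounded_continuousP; split; last by exists M => z; exact: fM.
  by move=> z; apply: continuous_comp; [exact: cv|exact: cf].
exists (MkCstar fv) => /=; first by rewrite (ext_equiv_pt vK uX).
by apply: val_inj; apply/funext => x /=; rewrite vX.
Qed.

Lemma gammaE Y : gamma (class_of Y) = gamma_ideal Y.
Proof.
have YZ := repr_extP Y; have ZY := ext_equiv_sym YZ.
rewrite /gamma /gamma_ideal.
have E : gamma_set (repr_ext (class_of Y)) = gamma_set Y.
  by apply/seteqP; split; exact: gamma_set_equiv.
move: (@gamma_set0 _) (@gamma_setD _) (@gamma_setM _); rewrite E => *.
by congr RingIdeal; exact: Prop_irrelevance.
Qed.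

End Gamma.

Section OrderIsomorphisms.
Variables (A B : Type) (leA : A -> A -> Prop) (leB : B -> B -> Prop).

Definition order_isomorphism (f : A -> B) : Prop :=
  exists g : B -> A,
    [/\ cancel f g, cancel g f, {homo f : x y / leA x y >-> leB x y}
      & {homo g : x y / leB x y >-> leA x y}].

End OrderIsomorphisms.

Section OntoImage.
Variables (A B : Type) (leA : A -> A -> Prop) (leB : B -> B -> Prop).
Variable f : A -> B.

Definition image_of : Type := {b : B | exists a, f a = b}.

Definition to_image (a : A) : image_of := exist _ (f a) (ex_intro _ a erefl).

Definition order_isomorphism_onto_image : Prop :=
  order_isomorphism leA (fun b c : image_of => leB (sval b) (sval c)) to_image.

End OntoImage.

(* Main.v *)
Require Import Defs.
From mathcomp Require Import all_boot all_order all_algebra.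
From mathcomp Require Import all_classical all_reals all_analysis.

(** Everything follows from the equivalence, for one-point extensions
    [Y = X \cup {p}] and [Z = X \cup {q}], of [Y <= Z] and
    [gamma Y `<=` gamma Z]: as the order of extension classes is antisymmetric,
    [gamma] is then injective, and its inverse on its image is monotone.

    If [u : Z -> Y] is continuous and fixes [X], then it sends [q] to [p]: were
    [u q] a point [x] of [X], the neighborhoods of [x] in [X] would have points
    in every neighborhood of [q], against the separation of [x] and [q] in [Z]
    ([ext_map_pt]). So [f \o u] vanishes at [q] when [f] vanishes at [p], and
    [f] and [f \o u] have the same restriction to [X] ([gamma_set_le]).

    Conversely, the only candidate for [u] fixes [X] and sends [q] to [p]. It is
    continuous at the points of [X] because [X] is open in [Z]. At [q], complete
    regularity of [Y] says that the traces on [X] of the neighborhoods of [p]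
    are generated by the sets where a function of [gamma Y] is less than [1];
    when [gamma Y `<=` gamma Z], such a set is also the trace of a neighborhood
    of [q] ([gamma_set_le_inv]). *)

Set Implicit Arguments.
Unset Strict Implicit.
Unset Printing Implicit Defensive.

Import Order.TTheory GRing.Theory Num.Theory numFieldNormedType.Exports.

Local Open Scope classical_set_scope.
Local Open Scope ring_scope.

Section OnePointExtensionMaps.
Variable X : topologicalType.
Implicit Types Y Z : one_point_extension X.

Lemma open_range_ext_incl Z : open (range (ext_incl Z)).
Proof.
rewrite -[range _]setCK ext_remainder openC.
by apply: accessible_closed_set1; apply: hausdorff_accessible;
  exact: (ext_tychonoff Z).2.
Qed.

(** Continuity at a point of [X] can be tested on [X], which is open. *)
Lemma ext_continuous_at_incl Z (T : topologicalType) (h : Z -> T) x :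
  {for x, continuous (h \o ext_incl Z)} ->
  {for ext_incl Z x, continuous h}.
Proof.
move=> ch W /ch; rewrite nbhs_simpl/= nbhsE => -[U [oU Ux] UW].
have [V oV VU] := ((ext_embedding Z).2 U).1 oU.
have : nbhs (ext_incl Z x) (V `&` range (ext_incl Z)).
  apply: open_nbhs_nbhs; split.
    exact: (openI oV (@open_range_ext_incl Z)).
  by split; [rewrite -VU in Ux|exists x].
apply: filterS => y [Vy [z _ zy]]; rewrite -zy in Vy *.
by apply: UW; rewrite -VU.
Qed.

(** If [u (ext_pt Z)] were the point [x] of [X], then [ext_incl Z x] would be a
    cluster point of the neighborhoods of [ext_pt Z] in the Hausdorff space
    [Z]. *)
Lemma ext_map_pt Y Z (u : Z -> Y) : continuous u ->
  (forall x, u (ext_incl Z x) = ext_incl Y x) -> u (ext_pt Z) = ext_pt Y.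
Proof.
move=> cu uX; have [//|[x xE]] := ext_cases (u (ext_pt Z)).
exfalso; apply: (@ext_incl_neq X Z x); apply: (ext_tychonoff Z).2 => A B.
move=> + Bp => /(@ext_incl_continuous X Z x); rewrite nbhs_simpl/= nbhsE.
move=> -[U [oU Ux] UA].
have [V oV VU] := ((ext_embedding Y).2 U).1 oU.
have : nbhs (ext_pt Z) (u @^-1` V `&` B).
  apply: filterI => //; apply: cu; rewrite -xE.
  by apply: open_nbhs_nbhs; split=> //; rewrite -VU in Ux.
rewrite nbhsE => -[W [oW Wp] WVB].
have [y [Wy [z _ zy]]] := @ext_dense _ Z W (ex_intro _ _ Wp) oW.
rewrite -zy in Wy.
have [/= Vz Bz] := WVB _ Wy.
by exists (ext_incl Z z); split=> //; apply: UA; rewrite -VU /= -uX.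
Qed.

Definition ext_map Y Z (z : Z) : Y :=
  if pselect (exists x, ext_incl Z x = z) is left xP
  then ext_incl Y (sval (cid xP)) else ext_pt Y.

Lemma ext_map_incl Y Z x : ext_map Y (ext_incl Z x) = ext_incl Y x.
Proof.
rewrite /ext_map; case: pselect => [xP|[]]; last by exists x.
by case: cid => x' xx' /=; have -> := (ext_embedding Z).1 _ _ xx'.
Qed.

Lemma ext_map_ext_pt Y Z : ext_map Y (ext_pt Z) = ext_pt Y.
Proof.
by rewrite /ext_map; case: pselect => // xP; have [x /ext_incl_neq] := xP.
Qed.

End OnePointExtensionMaps.

Section GammaOrder.
Variables (R : realType) (X : topologicalType).
Implicit Types Y Z : one_point_extension X.

Lemma gamma_set_le Y Z : ext_le Y Z -> @gamma_set R X Y `<=` @gamma_set R X Z.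
Proof.
move=> [u cu uX] _ [f fp <-].
have /bounded_continuousP[cf [M fM]] := Cstar_subproof f.
have fu : f \o u \in @bounded_continuous R Z.
  apply/bounded_continuousP; split; last by exists M => z; exact: fM.
  by move=> z; apply: continuous_comp; [exact: cu|exact: cf].
exists (MkCstar fu) => /=; first by rewrite (ext_map_pt cu uX).
by apply: val_inj; apply/funext => x /=; rewrite uX.
Qed.

(** Each neighborhood [B] of [ext_pt Y] contains [{g < 1}] for a function [g]
    vanishing at [ext_pt Y]. By hypothesis [g] and some [k] on [Z] vanishing at
    [ext_pt Z] agree on [X], so [ext_map Y] sends [{k < 1}] into [B]. *)
Lemma gamma_set_le_inv Y Z :
  @gamma_set R X Y `<=` @gamma_set R X Z -> ext_le Y Z.
Proof.
move=> YZ; exists (@ext_map X Y Z); last exact: ext_map_incl.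
move=> z; have [->|[x <-]] := ext_cases z; last first.
  apply: ext_continuous_at_incl.
  have -> : @ext_map X Y Z \o ext_incl Z = ext_incl Y.
    by apply/funext => t; exact: ext_map_incl.
  exact: ext_incl_continuous.
move=> B; rewrite /= ext_map_ext_pt nbhsE => -[V [oV Vp] VB].
have nVp : ~ (~` V) (ext_pt Y) by apply.
have /(@uniform_separatorP _ R)[g [cg g01 g0 g1]] :=
  (ext_tychonoff Y).1 _ _ (open_closedC oV) nVp.
have g_bc : g \in @bounded_continuous R Y.
  apply/bounded_continuousP; split=> //; exists 1 => y.
  have /= := g01 (g y) (ex_intro2 _ _ y I erefl).
  by rewrite in_itv/= => /andP[g_ge0 g_le1]; rewrite ger0_norm.
have [] := YZ (ext_restr (MkCstar g_bc)).
  by exists (MkCstar g_bc) => //=; apply: g0; exists (ext_pt Y).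
move=> k /= kp kg.
have kX x : k (ext_incl Z x) = g (ext_incl Y x).
  by have /(congr1 (fun h : Cstar R X => h x)) := kg.
have /bounded_continuousP[ck _] := Cstar_subproof k.
have : nbhs (ext_pt Z) (k @^-1` [set r | r < 1]).
  apply: ck; apply: open_nbhs_nbhs; split; first exact: open_lt.
  by rewrite /= kp ltr01.
apply: filterS => y; apply: contraPP => nB /=.
have [yp|[x xy]] := ext_cases y.
  by exfalso; apply: nB; apply: VB; rewrite yp ext_map_ext_pt.
rewrite /= -xy ext_map_incl in nB; rewrite -xy kX.
have -> : g (ext_incl Y x) = 1.
  by apply: g1; exists (ext_incl Y x) => // Vx; exact/nB/VB.
by rewrite ltxx.
Qed.

Lemma gamma_leP (C D : extension_class X) :
  ideal_le (gamma R C) (gamma R D) <-> class_le C D.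
Proof. by split; [exact: gamma_set_le_inv|exact: gamma_set_le]. Qed.

End GammaOrder.

Section OrderReflecting.
Variables (A B : Type) (leA : A -> A -> Prop) (leB : B -> B -> Prop).
Variable f : A -> B.

(** Antisymmetry of [leA] and reflexivity of [leB] make such an [f] injective;
    the inverse is a choice of preimages. *)
Lemma reflecting_order_isomorphism_onto_image :
  (forall x y, leA x y -> leA y x -> x = y) -> (forall b, leB b b) ->
  (forall x y, leB (f x) (f y) <-> leA x y) ->
  order_isomorphism_onto_image leA leB f.
Proof.
move=> anti refl fP; pose g (b : image_of f) := sval (cid (svalP b)).
have fg b : f (g b) = sval b by rewrite /g; case: cid.
exists g; split.
- by move=> x; apply: anti; apply/fP; rewrite fg.
- by case=> b bP; apply: eq_exist => /=; rewrite fg.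
- by move=> x y /fP.
- by move=> b c bc; apply/fP; rewrite !fg.
Qed.

End OrderReflecting.

Theorem lemma7p1 (R : realType) (X : topologicalType)
    (hX : tychonoff_space X) :
  order_isomorphism_onto_image (@class_le X) (@ideal_le (Cstar R X))
    (@gamma R X).
Proof.
apply: reflecting_order_isomorphism_onto_image.
- exact: class_le_anti.
- by move=> I a.
- exact: gamma_leP.
Qed.
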